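(* Let $n \geq 6$ and $m \geq n$ be integers. Then the product $(m+1)(m+2)\cdots(m+n)$ of $n$ consecutive integers strictly greater than $n$ is divisible by at least two distinct primes strictly greater than $n$. *)

(* Defs.v *)
From mathcomp Require Import all_boot.
Set Implicit Arguments. Unset Strict Implicit. Unset Printing Implicit Defensive.

(* Main.v *)
(** Call x rough if it has a prime factor > n. Two rough terms of (m, m + n] give
    two primes, since a prime > n divides at most one term of the window. So
    suppose that at most one term is rough, and let N = m + n and C = 'C(N, n).
    Every prime power p ^ logn p C is at most N, and the part of C prime to n!
    divides the rough term, so C <= N ^ (pi(n) + 1), following Erdos's proof of
    Sylvester's theorem.
    - For n < 48 this bounds m, and finitely many windows remain.
    - For n >= 48 we have 3 (pi(n) + 1) <= n, and therefore
      64 (m + 1)^3 N <= (n + 1)^6. If m < 2^18, a list of primes with gaps of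
      order m^(2/3) provides two primes in the window.
    - If m >= 2^18, let s be the integer square root of N. Primes p > s divide C
      at most once, and not at all if N / 3 < p <= n, so Chebyshev's bound
      on the primorial gives C <= N ^ (pi(s) + 1) * 4 ^ min(n, N / 3). As
      C >= 4 ^ n * (3/2) ^ r / (2 n) with r = min(n, N - 2 n), this yields
      (27/8) ^ n <= (2 n)^3 N ^ s, contradicting n >> N^(2/3). *)

Require Import Defs.
From mathcomp Require Import all_boot.
From mathcomp Require Import zify.
From Stdlib Require Import BinNat.

Set Implicit Arguments. Unset Strict Implicit. Unset Printing Implicit Defensive.

(** * The bound pi(n) + 1 <= n / 3 *)

Definition primepi n := count prime (iota 0 n.+1).

Lemma prime_mod6 p : 3 < p -> prime p -> p %% 6 \in [:: 1; 5].
Proof.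
move=> p3 /primeP [_ pr]; have := pr 2; have := pr 3.
have : p %% 6 < 6 by rewrite ltn_mod.
rewrite !dvdn_eq !inE => h /(_ _) d3 /(_ _) d2.
lia.
Qed.

(** Six consecutive integers above 3 contain at most two primes, so the bound propagates from n - 6
    to n. The base cases 48 to 53 are computed; at 48 equality holds. *)
Lemma primepi_le_third n : 48 <= n -> 3 * (primepi n).+1 <= n.
Proof.
have step k : 3 <= k -> primepi (k + 6) <= (primepi k).+2.
  move=> k3; rewrite /primepi -addSn iotaD count_cat -(addn2 (count _ _)) leq_add2l add0n.
  apply: (@leq_trans (count (fun x => x %% 6 \in [:: 1; 5]) (iota k.+1 6))).
    rewrite -!size_filter; apply: uniq_leq_size; first exact/filter_uniq/iota_uniq.
    move=> p; rewrite !mem_filter mem_iota => /andP[pr_p /andP[kp ->]].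
    by rewrite prime_mod6 // ?kp //; lia.
  rewrite (divn_eq k.+1 6); have : k.+1 %% 6 < 6 by rewrite ltn_mod.
  move: (k.+1 %/ 6) (k.+1 %% 6) => q r r6.
  rewrite /= -!addnS !modnMDl.
  by do 6 (case: r r6 => [|r] r6 //).
elim/ltn_ind: n => n IH n48.
have [n54|n54] := leqP 54 n.
  have /= := step (n - 6); rewrite subnK; last by lia.
  have := IH (n - 6); lia.
have -> : n = 48 + (n - 48) by lia.
have : n - 48 < 6 by lia.
by move: (n - 48) => r; do 6 (case: r => [|r] //).
Qed.

(** * Legendre's formula and prime powers in binomials *)

Lemma logn_fact_bounded M n p : prime p -> n <= M ->
  logn p n`! = \sum_(1 <= i < M.+1) n %/ p ^ i.
Proof.
move=> pr_p nM; rewrite logn_fact // [RHS](big_cat_nat (n := n.+1)) //=.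
suff -> : \sum_(n.+1 <= i < M.+1) n %/ p ^ i = 0 by rewrite addn0.
rewrite big_nat_cond big1 // => i /andP[/andP[ni _] _].
by apply: divn_small; apply: ltn_trans ni (ltn_expl _ _); apply: prime_gt1.
Qed.

(** With a common upper limit, the Legendre sums of N!, k! and (N - k)! compare termwise: index i
    contributes at most 1 to the exponent, and nothing once p ^ i > N. *)
Lemma leq_pexp_logn_bin N k p : prime p -> 0 < N -> k <= N -> p ^ logn p 'C(N, k) <= N.
Proof.
case: N => // N pr_p _ kN; have p1 := prime_gt1 pr_p.
set t := trunc_log p N.+1.
suff : logn p 'C(N.+1, k) <= t.
  by rewrite -(leq_exp2l _ _ p1) => /leq_trans; apply; apply: trunc_logP.
have tN : t <= N.+1.
  by apply: ltnW; apply: leq_trans (ltn_expl t p1) (trunc_logP _ _).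
have := congr1 (logn p) (bin_fact kN).
rewrite lognM ?muln_gt0 ?fact_gt0 ?bin_gt0 // lognM ?fact_gt0 //.
rewrite !(@logn_fact_bounded N.+1) ?leq_subr // -big_split /= => E.
rewrite -(leq_add2r (\sum_(1 <= i < N.+2) (k %/ p ^ i + (N.+1 - k) %/ p ^ i))) E.
have <- : \sum_(1 <= i < N.+2) (i < t.+1) = t.
  transitivity (\sum_(1 <= i < t.+1) 1); last by rewrite sum_nat_const_nat subn1 muln1.
  by rewrite (big_nat_widen 1 t.+1 N.+2) // [RHS]big_mkcond; apply: eq_bigr => i _; case: ltnP.
rewrite -big_split /=; apply: leq_sum => i _ /=.
have [it|ti] := ltnP i t.+1.
  by rewrite addnC -{1}(subnKC kN) leq_divDl.
rewrite divn_small //; apply: leq_trans (trunc_log_ltn _ p1) _.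
by rewrite leq_exp2l.
Qed.

(** * Chebyshev's bound on the primorial *)

Lemma partn_ltn b M :
  M`_[pred p | p < b] = \prod_(0 <= p < b | prime p) p ^ logn p M.
Proof.
rewrite (widen_partn (m := b + M)) ?leq_addl // -(big_nat_widen _ _ _ xpredT) ?leqW ?leq_addr //.
rewrite [RHS]big_mkcond; apply: eq_bigr => p _.
by case: ifP => // npr; rewrite lognE npr.
Qed.

Lemma Euclid_dvd_fact p n : prime p -> (p %| n`!) = (p <= n).
Proof.
move=> pr_p; elim: n => [|n IH]; first by rewrite Euclid_dvd1 // leqNgt prime_gt0.
apply/idP/idP => [|le_pn]; last by rewrite dvdn_fact ?prime_gt0.
by rewrite factS Euclid_dvdM // IH => /orP[/dvdn_leq->//|/leqW].
Qed.

(** An even n > 2 adds no prime. For n = 2 j + 1, the primes in (j + 1, n] all divide 'C(n, j), and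
    induction handles those up to j + 1. *)
Lemma primorial_le n : \prod_(0 <= p < n.+1 | prime p) p <= 4 ^ n.
Proof.
elim/ltn_ind: n => n IH.
have [|n2] := leqP n 2.
  by case: n {IH} => [|[|[|]]] // _; rewrite unlock.
have [odd_n|even_n] := boolP (odd n); last first.
  case: n n2 even_n IH => // n n2 even_n IH.
  rewrite big_mkcond big_nat_recr //= -big_mkcond /= ifF.
    by rewrite muln1 (leq_trans (IH n _)) // leq_exp2l.
  apply/negbTE/negP => pr; have := even_prime pr; rewrite (negbTE even_n); lia.
have [j nE] : exists j, n = j.*2.+1 by exists n./2; rewrite -[LHS]odd_double_half odd_n.
rewrite (big_cat_nat (n := j.+2)) /=; [|by []|lia].
have -> : n = j.+1 + j by lia.
rewrite expnD leq_mul ?IH //; first by lia.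
set M := 'C(j.+1 + j, j).
have M_gt0 : 0 < M by rewrite bin_gt0 leq_addl.
(* The two equal middle coefficients both occur in the expansion of (1 + 1) ^ (2 j + 1). *)
have MM : M <= 4 ^ j.
  have := Pascal 1 1 (j.+1 + j).
  rewrite (bigD1 (inord j)) //= (bigD1 (inord j.+1)) /=; last first.
    by apply/eqP => /(congr1 val) /=; rewrite !inordK; lia.
  rewrite !exp1n !muln1 !inordK; try lia.
  have -> : 'C(j.+1 + j, j.+1) = M by rewrite /M -[RHS]bin_sub ?leq_addl // addnK.
  have -> : (1 + 1) ^ (j.+1 + j) = 2 * 4 ^ j.
    by rewrite (_ : j.+1 + j = (2 * j).+1) ?expnS ?expnM //; lia.
  lia.
apply: leq_trans MM.
apply: (@leq_trans (\prod_(j.+2 <= p < (j.+1 + j).+1 | prime p) p ^ logn p M)).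
  rewrite big_nat_cond [leqRHS]big_nat_cond; apply: leq_prod => p /andP[/andP[jp pn] pr_p].
  rewrite -{1}(expn1 p) leq_exp2l ?prime_gt1 // logn_gt0 mem_primes pr_p M_gt0 /=.
  have : p %| (j.+1 + j)`! by rewrite Euclid_dvd_fact.
  have jn : j <= j.+1 + j by lia.
  rewrite -(bin_fact jn) addnK Euclid_dvdM // => /orP[//|].
  rewrite (Euclid_dvdM j`!) // !Euclid_dvd_fact //; lia.
have := partn_ltn (j.+1 + j).+1 M; rewrite (big_cat_nat (n := j.+2)) //=; last by lia.
move=> E; have := dvdn_leq M_gt0 (dvdn_part [pred p | p < (j.+1 + j).+1] M).
rewrite E => le_M; apply: leq_trans le_M; apply: leq_pmull.
by apply: prodn_cond_gt0 => p pr_p; rewrite expn_gt0 prime_gt0.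
Qed.

(** * Small, large and middle primes in a binomial *)

Lemma leq_prod_nat_cut b c (P : pred nat) F : (forall p, P p -> 0 < F p) ->
  \prod_(0 <= p < b | P p && (p < c)) F p <= \prod_(0 <= p < c | P p) F p.
Proof.
move=> F_gt0; rewrite (big_nat_widen 0 c (b + c)) ?leq_addl //.
rewrite [leqRHS](big_cat_nat (n := b)) ?leq_addr //=.
by rewrite leq_pmulr // prodn_cond_gt0 // => p /andP[/F_gt0].
Qed.

(** Each prime up to s contributes at most N; the larger ones contribute at most the primorial of
    t. *)
Lemma prod_prime_logn_bin_le N k s t : 0 < N -> k <= N ->
    (forall p, prime p -> s < p <= k -> logn p 'C(N, k) <= (p <= t)) ->
  \prod_(0 <= p < k.+1 | prime p) p ^ logn p 'C(N, k) <= N ^ primepi s * 4 ^ t.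
Proof.
move=> N_gt0 kN le_logn.
apply: (@leq_trans (\prod_(0 <= p < k.+1 | prime p)
    ((if p < s.+1 then N else 1) * (if p < t.+1 then p else 1)))).
  rewrite big_nat_cond [leqRHS]big_nat_cond; apply: leq_prod => p /andP[/andP[_ pk] pr_p].
  have p_gt0 := prime_gt0 pr_p; have le_pN := leq_pexp_logn_bin pr_p N_gt0 kN.
  case: ifP => [ps|/negbT]; first by rewrite (leq_trans le_pN) // leq_pmulr //; case: ifP.
  rewrite -leqNgt mul1n => sp; have := le_logn p pr_p; rewrite sp -ltnS pk => /(_ isT).
  rewrite -[p <= t]ltnS => le1; apply: (@leq_trans (p ^ (p < t.+1))).
    by rewrite leq_exp2l ?prime_gt1.
  by case: ifP; rewrite ?expn1.
rewrite big_split -!big_mkcondr leq_mul //=.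
  apply: leq_trans (leq_prod_nat_cut _ _ _) _ => //.
  by rewrite big_const_seq iter_muln_1.
by apply: leq_trans (leq_prod_nat_cut _ _ _) (primorial_le _) => p /prime_gt0.
Qed.

Lemma logn_bin_le1 N k p : prime p -> 0 < N -> k <= N -> N < p ^ 2 ->
  logn p 'C(N, k) <= 1.
Proof.
move=> pr_p N_gt0 kN Np; rewrite leqNgt; apply/negP => l2.
have := leq_trans Np (leq_pexp2l (prime_gt0 pr_p) l2).
by rewrite ltnNge leq_pexp_logn_bin.
Qed.

Lemma logn_fact_lt_sqr p n : prime p -> n < p ^ 2 -> logn p n`! = n %/ p.
Proof.
move=> pr_p np; rewrite logn_fact //; case: n np => [|n] np.
  by rewrite big_nil div0n.
rewrite big_ltn // expn1 big_nat_cond big1 ?addn0 // => i /andP[/andP[i2 _] _].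
by apply: divn_small; apply: leq_trans np _; rewrite leq_exp2l // prime_gt1.
Qed.

(** The quotients of N, k and N - k by p are 2, 1 and 1, which cancel. *)
Lemma logn_bin_middle p N k : prime p -> N < p ^ 2 -> k.*2 <= N -> p <= k ->
  N < 3 * p -> logn p 'C(N, k) = 0.
Proof.
move=> pr_p Np kN pk N3p; have kN' : k <= N by lia.
have := congr1 (logn p) (bin_fact kN').
rewrite lognM ?muln_gt0 ?fact_gt0 ?bin_gt0 // lognM ?fact_gt0 //.
rewrite !logn_fact_lt_sqr //; try by apply: leq_ltn_trans Np; lia.
have divE q a : q * p <= a < q.+1 * p -> a %/ p = q.
  move=> qa; apply/eqP.
  by rewrite eqn_leq leq_divRL ?prime_gt0 // -ltnS ltn_divLR ?prime_gt0 // andbC.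
rewrite (divE 2 N) ?(divE 1 k) ?(divE 1 (N - k)); lia.
Qed.

(** * Upper bounds on the binomial with at most one rough term *)

Definition rough_count n m := count (fun x => n < max_pdiv x) (iota m.+1 n).

Lemma leq_partn_rough n s B : 0 < B -> all (fun x => 0 < x <= B) s ->
  (\prod_(x <- s) x)`_[pred p | p < n.+1]^' <= B ^ count (fun x => n < max_pdiv x) s.
Proof.
move=> B_gt0; elim: s => [|x s IH] /=; first by rewrite big_nil partn1.
move=> /andP[/andP[x_gt0 xB] s_B]; rewrite big_cons partnM //; last first.
  rewrite big_seq_cond prodn_cond_gt0 // => y /andP[ys _].
  by have /andP[] := allP s_B y ys.
rewrite expnD leq_mul ?IH //; case: ltnP => [_|x_smooth].
  by rewrite expn1 (leq_trans _ xB) // dvdn_leq // dvdn_part.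
rewrite expn0 (_ : _`_ _ = 1) //; apply/eqP; rewrite partn_eq1 //.
rewrite /pnat x_gt0; apply/allP => p p_x; rewrite !inE negbK ltnS.
exact: leq_trans (max_pdiv_max p_x) x_smooth.
Qed.

Lemma fact_bin_prod m n : n`! * 'C(m + n, n) = \prod_(i < n) (m.+1 + i).
Proof.
rewrite mulnC bin_ffact ffact_prod [RHS](reindex_inj rev_ord_inj) /=.
by apply: eq_bigr => i _; have := ltn_ord i; lia.
Qed.

(** The part of C made of primes above n divides the corresponding part of the window's product, to
    which only the rough term contributes. *)
Lemma bin_le_smooth_part m n : 0 < n -> rough_count n m <= 1 ->
  'C(m + n, n) <= (m + n) * \prod_(0 <= p < n.+1 | prime p) p ^ logn p 'C(m + n, n).
Proof.
move=> n_gt0 rc; have C_gt0 : 0 < 'C(m + n, n) by rewrite bin_gt0 leq_addl.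
rewrite -{1}(partnC [pred p | p < n.+1] C_gt0) partn_ltn mulnC leq_mul //.
have P_gt0 : 0 < \prod_(x <- iota m.+1 n) x.
  rewrite big_seq_cond prodn_cond_gt0 // => x; rewrite mem_iota; lia.
have dvd_P : 'C(m + n, n) %| \prod_(x <- iota m.+1 n) x.
  rewrite -[m.+1]addn0 iotaDl big_map -[n in iota 0 n]subn0 -/(index_iota 0 n).
  by rewrite big_mkord -fact_bin_prod dvdn_mull.
have le_P := dvdn_leq (part_gt0 _ _) (partn_dvd [pred p | p < n.+1]^' P_gt0 dvd_P).
apply: leq_trans le_P _; apply: (@leq_trans ((m + n) ^ rough_count n m)).
  by apply: leq_partn_rough; [lia | apply/allP => x; rewrite mem_iota; lia].
by rewrite -[leqRHS]expn1 leq_pexp2l //; lia.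
Qed.

Lemma bin_le_exp_primepi m n : 0 < n -> rough_count n m <= 1 ->
  'C(m + n, n) <= (m + n) ^ (primepi n).+1.
Proof.
move=> n_gt0 /(bin_le_smooth_part n_gt0) /leq_trans; apply.
rewrite expnS leq_mul2l -[_ ^ primepi n]muln1 -[1 in leqRHS](expn0 4).
by apply/orP; right; apply: prod_prime_logn_bin_le => [||p _]; lia.
Qed.

(** Cubing turns the exponent pi(s) + 1 into at most s, by [primepi_le_third]. *)
Lemma bin_cube_le m n s : 0 < n <= m -> rough_count n m <= 1 ->
    m + n < s.+1 ^ 2 -> 48 <= s ->
  'C(m + n, n) ^ 3 <= (m + n) ^ s * 4 ^ minn (3 * n) (m + n).
Proof.
move=> /andP[n_gt0 nm] rc lt_Ns s48; set t := minn n ((m + n) %/ 3).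
have le_C : 'C(m + n, n) <= (m + n) ^ (primepi s).+1 * 4 ^ t.
  apply: leq_trans (bin_le_smooth_part n_gt0 rc) _.
  rewrite expnS -mulnA leq_mul2l; apply/orP; right.
  apply: prod_prime_logn_bin_le => [||p pr_p /andP[sp pn]]; try lia.
  have lt_Np : m + n < p ^ 2 by apply: leq_trans lt_Ns _; rewrite leq_exp2r.
  have [pt|tp] := leqP p t; first by apply: logn_bin_le1; lia.
  by rewrite logn_bin_middle; lia.
rewrite -(leq_exp2r _ _ (isT : 0 < 3)) in le_C.
apply: leq_trans le_C _; rewrite expnMn -!expnM leq_mul //.
  by rewrite leq_pexp2l ?addn_gt0 ?n_gt0 ?orbT // mulnC primepi_le_third.
by rewrite leq_exp2l //; lia.
Qed.

(** * Lower bounds on binomials and the resulting inequalities *)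

Lemma exp4_le_central_bin n : 0 < n -> 4 ^ n <= 2 * n * 'C(2 * n, n).
Proof.
elim: n => // [[|n]] IH _ //; have {IH} := IH isT; move: n.+1 => {}n.
have := mul_bin_diag (2 * n).+2 n; have := mul_bin_down (2 * n).+1 n.
rewrite /= (_ : (2 * n).+2 = 2 * n.+1); last by lia.
rewrite (_ : (2 * n).+1 - n = n.+1) ?expnS; last by lia.
nia.
Qed.

(** Passing from r to r + 1 multiplies the binomial by (2 n + r + 1) / (n + r + 1), which is at
    least 3/2 as long as r < n. *)
Lemma bin_lower n r : 0 < n -> r <= n ->
  4 ^ n * 3 ^ r <= 2 * n * 2 ^ r * 'C(2 * n + r, n).
Proof.
move=> n_gt0; elim: r => [_|r IH rn].
  by rewrite !muln1 addn0 exp4_le_central_bin.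
have {IH} := IH (ltnW rn); have := mul_bin_down (2 * n + r).+1 n.
rewrite /= addnS (_ : (2 * n + r).+1 - n = (n + r).+1) => [E le_r|]; last by lia.
have le_C : 3 * 'C(2 * n + r, n) <= 2 * 'C((2 * n + r).+1, n) by nia.
rewrite !expnS mulnCA (leq_trans (leq_mul (leqnn 3) le_r)) //.
have := leq_mul (leqnn (2 * n * 2 ^ r)) le_C; lia.
Qed.

(* The lower bound on the binomial is taken at 2 n + r, with r = min(n, m - n),
   so that 2 n + r = min(3 n, m + n) matches the exponent of [bin_cube_le]. *)
Lemma exp27_le m n s : 0 < n <= m -> rough_count n m <= 1 ->
    m + n < s.+1 ^ 2 -> 48 <= s ->
  27 ^ n <= 8 ^ n * (2 * n) ^ 3 * (m + n) ^ s.
Proof.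
move=> /andP[n_gt0 nm] rc lt_Ns s48.
have := bin_cube_le _ rc lt_Ns s48; rewrite n_gt0 nm => /(_ isT) le_C.
pose r := minn n (m - n); have rn : r <= n by exact: geq_minl.
rewrite (_ : minn _ _ = 2 * n + r) in le_C; last by lia.
have le_C' : 'C(2 * n + r, n) <= 'C(m + n, n) by apply: leq_bin2l; lia.
have := leq_trans (bin_lower n_gt0 rn) (leq_mul (leqnn _) le_C').
rewrite -(leq_exp2r _ _ (isT : 0 < 3)) !expnMn => le1.
have {le1 le_C le_C'} := leq_trans le1 (leq_mul (leqnn _) le_C).
rewrite -!expnM !(mulnC _ 3) !expnM expnD expnM.
rewrite (_ : 4 ^ 3 = 4 * 16) // (_ : 4 ^ 2 = 16) // (_ : 3 ^ 3 = 27) // (_ : 2 ^ 3 = 8) //.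
rewrite expnMn => le1.
have le2 : 4 ^ n * 27 ^ r <= (2 * n) ^ 3 * 32 ^ r * (m + n) ^ s.
  have e16 : 0 < 16 ^ n by rewrite expn_gt0.
  rewrite -(leq_pmul2r e16) (_ : 32 = 8 * 4) // !expnMn; lia.
have le3 : 32 ^ r * 27 ^ (n - r) <= 4 ^ n * 8 ^ n.
  rewrite -expnMn -[n in leqRHS](subnKC rn) expnD leq_mul //.
  by case: (n - r) => // k; rewrite leq_exp2r.
have e4 : 0 < 4 ^ n by rewrite expn_gt0.
rewrite -(leq_pmul2l e4) -[n in 27 ^ n](subnKC rn) expnD mulnA.
apply: leq_trans (leq_mul le2 (leqnn _)) _.
have := leq_mul (leqnn ((2 * n) ^ 3 * (m + n) ^ s)) le3; lia.
Qed.

(** Let P = n! C be the window's product. Pairing opposite factors gives P^2 >= ((m + 1) N)^n and,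
    by AM-GM, 4^n n!^2 <= (n + 1)^(2 n). Insert these and C^3 <= N^n in 64^n P^6 = (4^n n!^2)^3
    (C^3)^2, then take n-th roots. *)
Lemma rough_sixth_power m n : 0 < n -> rough_count n m <= 1 -> 48 <= n ->
  64 * m.+1 ^ 3 * (m + n) <= n.+1 ^ 6.
Proof.
move=> n_gt0 rc n48; have N_gt0 : 0 < m + n by lia.
have exp_prod x : x ^ n = \prod_(i < n) x by rewrite prod_nat_const card_ord.
have sqr_prod a : (a.+1 * (a + n)) ^ n <= (\prod_(i < n) (a.+1 + i)) ^ 2.
  rewrite expnS expn1 {2}(reindex_inj rev_ord_inj) -big_split /=.
  rewrite exp_prod; apply: leq_prod => i _.
  have := ltn_ord i; nia.
have fact_sqr : 4 ^ n * n`! ^ 2 <= n.+1 ^ (2 * n).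
  have -> : n`! = \prod_(i < n) (1 + i).
    by rewrite -(fact_bin_prod 0) binn muln1.
  rewrite expnS expn1 {2}(reindex_inj rev_ord_inj) -big_split /=.
  rewrite expnM !exp_prod -big_split /=.
  apply: leq_prod => i _; have ltin := ltn_ord i.
  have -> : n.+1 = (1 + i) + (1 + (n - i.+1)) by lia.
  exact: nat_AGM2.
have := sqr_prod m; rewrite -fact_bin_prod => le_P.
have le_C := bin_le_exp_primepi n_gt0 rc.
have le_C3 : 'C(m + n, n) ^ 3 <= (m + n) ^ n.
  apply: leq_trans (_ : ((m + n) ^ (primepi n).+1) ^ 3 <= _).
    by rewrite leq_exp2r.
  by rewrite -expnM leq_pexp2l // mulnC primepi_le_third.
rewrite -(leq_exp2r _ _ n_gt0).
have e1 : 0 < (m + n) ^ (2 * n) by rewrite expn_gt0 N_gt0.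
rewrite -(leq_pmul2r e1).
apply: (@leq_trans (64 ^ n * ((m.+1 * (m + n)) ^ n) ^ 3)).
  rewrite (mulnC 2) expnM !expnMn.
  by rewrite -!mulnA -expnS.
apply: (@leq_trans (64 ^ n * ((n`! * 'C(m + n, n)) ^ 2) ^ 3)).
  by rewrite leq_mul2l leq_exp2r ?le_P ?orbT.
apply: (@leq_trans ((4 ^ n * n`! ^ 2) ^ 3 * ('C(m + n, n) ^ 3) ^ 2)).
  rewrite (_ : 64 = 4 ^ 3) // (expnAC 4).
  move: (4 ^ n) n`! 'C(m + n, n) => a b c.
  by rewrite (expnMn b c) (expnMn (b ^ 2)) (expnMn a) -!expnM mulnA.
apply: leq_mul; last by rewrite [2 * n]mulnC expnM leq_exp2r.
have -> : (n.+1 ^ 6) ^ n = (n.+1 ^ (2 * n)) ^ 3 by rewrite -!expnM; congr (_ ^ _); lia.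
by rewrite leq_exp2r.
Qed.

(** * Large m *)

Lemma exists_sqrt N : exists s, s ^ 2 <= N < s.+1 ^ 2.
Proof.
elim: N => [|N [s sN]]; first by exists 0.
have [lt|ge] := ltnP N.+1 (s.+1 ^ 2); first by exists s; lia.
by exists s.+1; nia.
Qed.

Lemma expn6_lt t : 18 <= t -> t.+1 ^ 6 < 200 * 2 ^ t.
Proof.
elim: t => // t IH; rewrite leq_eqVlt => /orP[/eqP <-|t18]; first lia.
have {IH} := IH t18; set x := t.+1 => IH.
have x_ge : 19 <= x by [].
have h2 : x.+1 ^ 2 * 8 <= 9 * x ^ 2 by nia.
have := h2; rewrite -(leq_exp2r _ _ (isT : 0 < 3)) (expnMn (x.+1 ^ 2)) (expnMn 9) -!expnM.
rewrite [2 ^ x]expnS; lia.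
Qed.

Lemma cancel_factor a b x y z w N : 0 < w -> 8 * (N * w) <= x -> z <= w ->
  a * x <= b * y * z -> 8 * a * N <= b * y.
Proof.
move=> w_gt0 le_x le_w le_ab; rewrite -(leq_pmul2r w_gt0).
apply: leq_trans (leq_mul (leqnn (b * y)) le_w); apply: leq_trans le_ab.
have -> : 8 * a * N * w = a * (8 * (N * w)) by lia.
by rewrite leq_mul2l le_x orbT.
Qed.

Lemma rough_count_large m n : 48 <= n <= m -> 2 ^ 18 <= m + n -> 1 < rough_count n m.
Proof.
move=> /andP[n48 nm] N18; rewrite ltnNge; apply/negP => rc.
have n_gt0 : 0 < n by lia.
have [s /andP[sN lt_Ns]] := exists_sqrt (m + n).
have s512 : 512 <= s by nia.
have N_gt0 : 0 < m + n by lia.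
pose t := trunc_log 2 (m + n).
have tN : 2 ^ t <= m + n by apply: trunc_logP.
have Nt : m + n < 2 ^ t.+1 by apply: trunc_log_ltn.
have t18 : 18 <= t by apply: trunc_log_max.
(* Since 2^19 < 27^4, the fourth power of [exp27_le] gives 2^(7 n) <= N^(4 (s + 3)); the factor (2
   n)^3 is absorbed into N^3. *)
have le7 : 7 * n <= 4 * (t.+1 * (s + 3)).
  rewrite -(leq_exp2l _ _ (isT : 1 < 2)).
  have := @exp27_le m n s; rewrite n_gt0 nm => /(_ isT rc lt_Ns) le27.
  have {}le27 : 27 ^ n <= 8 ^ n * (m + n) ^ (s + 3).
    apply: leq_trans (le27 _) _; first lia.
    by rewrite -mulnA (addnC s) expnD leq_mul // leq_mul // leq_exp2r //; lia.
  rewrite -(leq_exp2r _ _ (isT : 0 < 4)) expnMn in le27.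
  have le19 : 2 ^ (19 * n) <= (27 ^ n) ^ 4.
    rewrite -(expnM 27) (mulnC n) (expnM 2) (expnM 27).
    have := leq_exp2r (2 ^ 19) (27 ^ 4) n_gt0 => ->; lia.
  have {le27 le19} := leq_trans le19 le27.
  rewrite (_ : 2 ^ (19 * n) = (8 ^ n) ^ 4 * 2 ^ (7 * n)); last first.
    by rewrite (_ : 8 = 2 ^ 3) // -!expnM -expnD; congr (_ ^ _); lia.
  rewrite leq_pmul2l ?expn_gt0 // => /leq_trans; apply.
  rewrite [4 * _]mulnC (expnM 2) leq_exp2r // (expnM 2).
  by rewrite leq_exp2r ?addn_gt0 ?orbT // ltnW.
(* 896 = 7 * 128 and 516 = 4 * 129, where s >= 512 gives s + 4 <= (129/128) s. *)
have le_n : 896 * n.+1 <= 516 * t.+1 * s.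
  have le_s : 128 * (s + 4) <= 129 * s by lia.
  have : 7 * n.+1 <= 4 * (t.+1 * (s + 4)) by nia.
  have := leq_mul (leqnn t.+1) le_s; lia.
have le8 : 8 * (m + n) ^ 4 <= n.+1 ^ 6.
  apply: leq_trans (rough_sixth_power n_gt0 rc n48).
  rewrite expnSr mulnA leq_mul2r (_ : 64 = 8 * 2 ^ 3) // -mulnA leq_mul2l -expnMn.
  by rewrite leq_exp2r ?orbT //; apply/orP; right; lia.
rewrite -(leq_exp2r _ _ (isT : 0 < 6)) !(expnMn _ _ 6) in le_n.
have le_s6 : s ^ 6 <= (m + n) ^ 3.
  by rewrite (_ : 6 = 2 * 3) // expnM leq_exp2r.
have N3_gt0 : 0 < (m + n) ^ 3 by rewrite expn_gt0 N_gt0.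
have := expn6_lt t18; rewrite ltnNge => /negP; apply.
(* As 8 (896/516)^6 > 200 and N >= 2^t, this contradicts [expn6_lt]. *)
have le_N : 8 * 896 ^ 6 * (m + n) <= 516 ^ 6 * t.+1 ^ 6.
  by rewrite expnS in le8; apply: (cancel_factor N3_gt0 le8 le_s6 le_n).
have := leq_mul (leqnn (8 * 896 ^ 6)) tN.
move: le_N; move: (2 ^ t) (t.+1 ^ 6) => a b; lia.
Qed.

(** * Certified primes and medium m *)

Fixpoint trial_division fuel (d x : N) : bool :=
  if fuel is fuel'.+1 then
    (x <? d * d)%num || (x mod d != 0)%num && trial_division fuel' (d + 1)%num x
  else false.

Lemma trial_division_prime fuel d x : (1 < d)%num -> (1 < x)%num ->
    (forall e, 1 < e < N.to_nat d -> ~~ (e %| N.to_nat x)) ->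
  trial_division fuel d x -> prime (N.to_nat x).
Proof.
elim: fuel d => //= fuel IH d d1 x1 no_div /orP[/N.ltb_lt dx|/andP[ndvd dvx]].
  apply: ltn_pdiv2_prime; first by lia.
  have : ~~ (pdiv (N.to_nat x) < N.to_nat d).
    apply/negP => lt_d; have := no_div (pdiv (N.to_nat x)).
    by rewrite lt_d pdiv_dvd prime_gt1 ?pdiv_prime; lia.
  nia.
apply: IH dvx => //; first by lia.
move=> e e_d.
have [lt_ed|ge_ed] := ltnP e (N.to_nat d); first by apply: no_div; lia.
have -> : e = N.to_nat d by lia.
apply: contra ndvd => /dvdnP[k xk]; apply/eqP.
by have -> : x = (N.of_nat k * d)%num; [lia | apply: N.Div0.mod_mul].
Qed.

(** Fuel 600 suffices for the primes used here: the largest is 268211 < 518^2. *)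
Definition prime_bin x := (1 <? x)%num && trial_division 600 2 x.

Lemma prime_binP x : prime_bin x -> prime (N.to_nat x).
Proof.
by case/andP=> /N.ltb_lt x1; apply: trial_division_prime => //; lia.
Qed.

(* For m < b, the primes b and c exceed m, and c - m <= c - a; the gap condition
   at a then gives the one at m. *)
Fixpoint prime_chain (a b : N) (l : seq N) : bool :=
  if l is c :: l' then
    [&& prime_bin c, (b <? c)%num, ((c - a) ^ 3 <? 8 * (a + 1) ^ 2)%num
      & prime_chain b c l']
  else (2 ^ 18 <=? a)%num.

Lemma prime_chainP a b l m : prime (N.to_nat b) -> prime_chain a b l ->
    N.to_nat a <= m < 2 ^ 18 ->
  exists p q, [/\ prime p, prime q, m < p < q & (q - m) ^ 3 < 8 * m.+1 ^ 2].
Proof.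
elim: l a b => [|c l IH] a b pr_b; first by move=> /N.leb_le; lia.
move=> /and4P[/prime_binP pr_c /N.ltb_lt bc /N.ltb_lt gap chain] m_a.
have [mb|bm] := ltnP m (N.to_nat b); last by apply: IH chain _ => //; lia.
exists (N.to_nat b), (N.to_nat c); split=> //; first by lia.
apply: (@leq_ltn_trans ((N.to_nat c - N.to_nat a) ^ 3)).
  by rewrite leq_exp2r //; lia.
apply: (@leq_trans (8 * (N.to_nat a).+1 ^ 2)).
  move: gap; have -> : (c - a)%num = N.of_nat (N.to_nat c - N.to_nat a) by lia.
  have -> : (a + 1)%num = N.of_nat (N.to_nat a).+1 by lia.
  move: (_ - _) (_.+1) => x y; lia.
by rewrite leq_mul2l leq_exp2r //; lia.
Qed.

(* In the list, each prime is the largest one within the allowed gap of the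
   prime two places before it. *)
Lemma two_primes_in_window m : 48 <= m < 2 ^ 18 ->
  exists p q, [/\ prime p, prime q, m < p < q & (q - m) ^ 3 < 8 * m.+1 ^ 2].
Proof.
move=> m_bd; have chain : prime_chain 47 53
    [:: 73; 79; 107; 113; 151; 157; 199; 211; 263; 281; 337; 367; 433; 467; 547;
        587; 677; 727; 829; 887; 997; 1069; 1193; 1277; 1409; 1511; 1657; 1759;
        1933; 2039; 2243; 2357; 2579; 2711; 2953; 3089; 3361; 3511; 3803; 3967;
        4289; 4463; 4817; 5003; 5387; 5581; 5987; 6203; 6637; 6871; 7333; 7591;
        8087; 8363; 8887; 9187; 9743; 10061; 10651; 10993; 11617; 11981; 12641;
        13009; 13723; 14107; 14869; 15271; 16073; 16493; 17341; 17783; 18679;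
        19141; 20071; 20563; 21529; 22063; 23071; 23633; 24691; 25261; 26371;
        26981; 28123; 28771; 29959; 30643; 31883; 32587; 33893; 34613; 35983;
        36721; 38153; 38923; 40387; 41213; 42737; 43597; 45181; 46073; 47717;
        48623; 50341; 51287; 53051; 54037; 55871; 56893; 58789; 59833; 61781;
        62873; 64901; 66029; 68113; 69263; 71443; 72623; 74873; 76103; 78401;
        79693; 82051; 83389; 85819; 87187; 89689; 91099; 93683; 95143; 97789;
        99289; 102031; 103577; 106397; 107981; 110881; 112507; 115471; 117167;
        120209; 121951; 125063; 126859; 130057; 131899; 135181; 137077; 140443;
        142391; 145829; 147827; 151357; 153409; 157037; 159119; 162853; 164987;
        168803; 170971; 174907; 177131; 181157; 183439; 187559; 189887; 194101;
        196477; 200797; 203233; 207653; 210143; 214663; 217207; 221831; 224429;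
        229157; 231809; 236641; 239347; 244291; 247031; 252101; 254899; 260081;
        262937; 268211]%num.
  by vm_compute.
  have pr53 := @prime_binP 53 isT.
by apply: prime_chainP pr53 chain _; lia.
Qed.

Lemma rough_count_medium m n : 48 <= n <= m -> m < 2 ^ 18 -> 1 < rough_count n m.
Proof.
move=> /andP[n48 nm] m18; rewrite ltnNge; apply/negP => rc.
have n_gt0 : 0 < n by lia.
have le6 := rough_sixth_power n_gt0 rc n48.
(* Square root of [rough_sixth_power] with N >= m + 1; the gap condition then forces q - m <= n. *)
have le3 : 8 * m.+1 ^ 2 <= n.+1 ^ 3.
  rewrite -(leq_exp2r _ _ (isT : 0 < 2)) -(expnM n.+1).
  apply: leq_trans le6; rewrite expnMn -expnM (expnSr m.+1 3) mulnA leq_mul //; lia.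
have [|p [q [pr_p pr_q /andP[mp pq] gap]]] := @two_primes_in_window m; first by lia.
have {gap le3} := leq_trans gap le3; rewrite ltn_exp2r // => qn.
move: rc; rewrite leqNgt => /negP; apply.
rewrite /rough_count -size_filter.
apply: (@uniq_leq_size _ [:: p; q]); first by rewrite /= inE; lia.
have rough x : prime x -> m < x <= m + n -> x \in [seq x <- iota m.+1 n | n < max_pdiv x].
  move=> pr_x m_x; rewrite mem_filter mem_iota; apply/andP; split; last by lia.
  apply: (@leq_trans x); [by lia | apply: max_pdiv_max].
  by rewrite mem_primes pr_x prime_gt0 //=.
by move=> x; rewrite !inE => /orP[] /eqP ->; apply: rough => //; lia.
Qed.

(** * Small n, by computation in binary *)

Fixpoint fact_bin n : N := if n is n'.+1 then (N.of_nat n * fact_bin n')%num else 1%num.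

Lemma fact_binE n : N.of_nat n`! = fact_bin n.
Proof.
elim: n => // n IH; rewrite factS.
by rewrite -[fact_bin _]/(N.of_nat n.+1 * fact_bin n)%num -IH; lia.
Qed.

(* Beyond this bound, m ^ (n - pi(n) - 1) > n! 2 ^ (pi(n) + 1), which contradicts
   C <= N ^ (pi(n) + 1) because N <= 2 m. *)
Definition small_bound n := if n == 7 then 402 else 120.

Lemma small_check : all (fun n =>
  [&& primepi n < n,
      (fact_bin n * 2 ^ N.of_nat (primepi n).+1
        <? N.of_nat (small_bound n) ^ N.of_nat (n - (primepi n).+1))%num
    & all (fun m => 1 < rough_count n m) (iota n (small_bound n - n))]) (iota 6 42).
Proof. by vm_compute. Qed.

Lemma rough_count_small m n : 6 <= n <= m -> n < 48 -> 1 < rough_count n m.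
Proof.
move=> /andP[n6 nm] n48; rewrite ltnNge; apply/negP => rc.
have n_gt0 : 0 < n by lia.
have := allP small_check n; rewrite mem_iota n6 n48 => /(_ isT).
move=> /and3P[pi_n /N.ltb_lt fact_lt /allP all_rough].
have le_bound : n <= small_bound n by rewrite /small_bound; case: ifP; lia.
have bound_m : small_bound n <= m.
  rewrite leqNgt; apply/negP => m_lt; have := all_rough m.
  by rewrite mem_iota nm subnKC // m_lt ltnNge rc => /(_ isT).
have lt_bound : n`! * 2 ^ (primepi n).+1 < small_bound n ^ (n - (primepi n).+1).
  by rewrite -fact_binE in fact_lt; lia.
have : m.+1 ^ n <= n`! * (2 * m) ^ (primepi n).+1.
  apply: (@leq_trans (n`! * 'C(m + n, n))).
    rewrite fact_bin_prod -[n in m.+1 ^ n]card_ord -prod_nat_const.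
    by apply: leq_prod => i _; lia.
  rewrite leq_mul // (leq_trans (bin_le_exp_primepi n_gt0 rc)) // leq_exp2r //; lia.
apply/negP; rewrite -ltnNge expnMn mulnA.
apply: (@leq_trans (m ^ n)); last by rewrite leq_exp2r.
have -> : m ^ n = m ^ (n - (primepi n).+1) * m ^ (primepi n).+1.
  by rewrite -expnD subnK.
rewrite ltn_pmul2r ?expn_gt0 ?(leq_trans n_gt0 nm) //.
apply: leq_trans lt_bound _.
by case: (n - _) => // k; rewrite leq_exp2r.
Qed.

(** * From two rough terms to two primes *)

Lemma rough_count_gt1 m n : 6 <= n <= m -> 1 < rough_count n m.
Proof.
move=> /andP[n6 nm]; have [n48|n48] := ltnP n 48.
  by apply: rough_count_small; rewrite ?n6.
have [m18|m18] := ltnP m (2 ^ 18); first by apply: rough_count_medium; rewrite ?n48.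
by apply: rough_count_large; [rewrite n48 | apply: leq_trans m18 (leq_addr _ _)].
Qed.

Theorem theorem2 (n m : nat) (hn : 6 <= n) (hm : n <= m) :
  exists p q : nat,
    p <> q /\
    [/\ prime p, n < p & p %| \prod_(1 <= i < n.+1) (m + i)] /\
    [/\ prime q, n < q & q %| \prod_(1 <= i < n.+1) (m + i)].
Proof.
have := @rough_count_gt1 m n; rewrite hn hm => /(_ isT).
rewrite /rough_count -size_filter.
set s := filter _ _; have : uniq s by rewrite filter_uniq ?iota_uniq.
have in_s z : z \in s -> [/\ m < z <= m + n, prime (max_pdiv z), n < max_pdiv z
    & max_pdiv z %| \prod_(1 <= i < n.+1) (m + i)].
  rewrite mem_filter mem_iota => /andP[n_z m_z]; split=> //.
    by rewrite max_pdiv_prime //; lia.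
  have z_in : z - m \in index_iota 1 n.+1 by rewrite mem_index_iota; lia.
  rewrite (bigD1_seq _ z_in (iota_uniq _ _)) dvdn_mulr //= subnKC ?max_pdiv_dvd //.
  by lia.
case: s in_s => [|x [|y s]] // in_s /= /andP[xs _] _.
have [m_x pr_x n_x dvd_x] := in_s x (mem_head _ _).
have [m_y pr_y n_y dvd_y] : _ := in_s y (mem_behead (s := x :: _) (mem_head _ _)).
exists (max_pdiv x), (max_pdiv y); split=> // eq_xy.
have xy : x != y by move: xs; rewrite inE negb_or => /andP[].
have dx := max_pdiv_dvd x; have dy := max_pdiv_dvd y; rewrite -eq_xy in dy.
(* A common prime above n would divide the difference of x and y, which is positive and below n. *)
have [lt_xy|lt_yx|eq] := ltngtP x y; last by rewrite eq eqxx in xy.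
  by have := dvdn_leq _ (dvdn_sub dy dx); lia.
by have := dvdn_leq _ (dvdn_sub dx dy); lia.
Qed.
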